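(* Let $X$ be a locally compact Hausdorff space and let $f,g\in C_0(X)$ with $f\neq 0$. Then $f\perp_B g$ if and only if $0\in\operatorname{conv}\{\overline{f(x)}g(x):x\in M_f\}$.
   Context: $\mathbb{K}$ is $\mathbb{R}$ or $\mathbb{C}$. $C_0(X)$ is the space of continuous functions $X\to\mathbb{K}$ vanishing at infinity, with the supremum norm $\|\cdot\|$. For $f\in C_0(X)$, the norm attaining set is $M_f:=\{x\in X:|f(x)|=\|f\|\}$. In a normed space over $\mathbb{K}$, $x$ is Birkhoff-James orthogonal to $y$, written $x\perp_B y$, if $\|x+\lambda y\|\ge\|x\|$ for all $\lambda\in\mathbb{K}$. $\operatorname{conv}$ denotes the convex hull in $\mathbb{K}$. *)

(* Defs.v *)
From HB Require Import structures.
From mathcomp Require Import all_boot all_order all_algebra.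
From mathcomp Require Import complex.
From mathcomp Require Import all_classical all_reals all_analysis.

Set Implicit Arguments.
Unset Strict Implicit.
Unset Printing Implicit Defensive.

Import Order.TTheory GRing.Theory Num.Theory.
Import numFieldNormedType.Exports.

Local Open Scope classical_set_scope.
Local Open Scope ring_scope.

Variant scalar_kind := RealScalars | ComplexScalars.

Definition scalar_field (R : realType) (k : scalar_kind) : numFieldType :=
  match k with RealScalars => R | ComplexScalars => R[i] end.

Definition scalar_conj (R : realType) (k : scalar_kind) :
    scalar_field R k -> scalar_field R k :=
  match k return scalar_field R k -> scalar_field R k with
  | RealScalars => id | ComplexScalars => @conjc R
  end.

Definition scalar_re (R : realType) (k : scalar_kind) : scalar_field R k -> R :=
  match k return scalar_field R k -> R with
  | RealScalars => id | ComplexScalars => @complex.Re R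
  end.

Definition scalar_of_real (R : realType) (k : scalar_kind) : R -> scalar_field R k :=
  match k return R -> scalar_field R k with
  | RealScalars => id | ComplexScalars => fun r => r%:C%C
  end.

Section ScalarTheory.
Context (R : realType) (k : scalar_kind).
Local Notation K := (scalar_field R k).
Local Notation re := (@scalar_re R k).
Local Notation inR := (@scalar_of_real R k).

Lemma scalar_of_realK : cancel inR re. Proof. by case: k. Qed.

Lemma scalar_reK (z : K) : z \is Num.real -> inR (re z) = z.
Proof. by case: k z => //= z; exact: RRe_real. Qed.

Lemma scalar_reB (z w : K) : re (z - w) = re z - re w.
Proof. by case: k z w => //= -[? ?] [? ?]. Qed.

Lemma scalar_of_realD : {morph inR : r s / r + s}.
Proof. by case: k => //= r s; exact: rmorphD. Qed.

Lemma scalar_of_realM : {morph inR : r s / r * s}.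
Proof. by case: k => //= r s; exact: rmorphM. Qed.

Lemma scalar_of_real0 : inR 0 = 0. Proof. by case: k. Qed.

Lemma ler_scalar_of_real : {mono inR : r s / r <= s}.
Proof. by case: k => //= r s; exact: lecR. Qed.

Lemma ltr_scalar_of_real : {mono inR : r s / r < s}.
Proof. by case: k => //= r s; exact: ltcR. Qed.

Lemma scalar_of_real_norm r : `|inR r| = inR `|r|.
Proof. by case: k => //=; rewrite normc_def /= expr0n addr0 sqrtr_sqr. Qed.

Lemma scalar_re_norm (z : K) : inR (re `|z|) = `|z|.
Proof. by rewrite scalar_reK. Qed.

End ScalarTheory.

Section BirkhoffJames.
Context {K : numFieldType} {V : normedModType K}.

Definition birkhoff_james_orthogonal (x y : V) :=
  forall lambda : K, `|x| <= `|x + lambda *: y|.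

End BirkhoffJames.

(* [convex_set] takes its weights in [K] between 0 and 1; as order-comparable
   complex numbers have the same imaginary part, these are real numbers in
   [0, 1] also when [K] is complex, so this is the usual real convex hull. *)
Definition convex_hull {K : numFieldType} (V : lmodType K) (A : set V) : set V :=
  smallest (@convex_set K V) A.

Definition vanishing_at_infinity {X : topologicalType} {K : numFieldType}
    (f : X -> K) :=
  forall e : K, 0 < e -> compact [set x | e <= `|f x|].

Section C0.
Context (R : realType) (k : scalar_kind) (X : topologicalType).
Local Notation K := (scalar_field R k).

Definition C0_pred : {pred X -> K^o} :=
  [pred f | `[< continuous f /\ vanishing_at_infinity f >]].

Record C0 := MkC0 { C0_fun :> X -> K^o ; C0_subproof : C0_fun \in C0_pred }.

HB.instance Definition _ := [isSub for C0_fun].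
HB.instance Definition _ := [Choice of C0 by <:].

Lemma C0_predP (f : X -> K^o) :
  reflect (continuous f /\ vanishing_at_infinity f) (f \in C0_pred).
Proof. exact: asboolP. Qed.

Lemma C0_submod_closed : submod_closed C0_pred.
Proof.
split => [|a f g].
  apply/C0_predP; split; first by move=> x; exact: cvg_cst.
  move=> e e0; rewrite (_ : [set _ | _] = set0); first exact: compact0.
  by apply/seteqP; split=> // x /=; rewrite normr0 lt_geF.
move=> /C0_predP[cf vf] /C0_predP[cg vg]; apply/C0_predP.
have ch : continuous (a *: f + g : X -> K^o).
  by move=> x; apply: cvgD; [apply: cvgZr; exact: cf | exact: cg].
split=> // e e0.
have a0 : 0 < `|a| + 1 by rewrite ltr_wpDl.
have e20 : 0 < e / 2 by rewrite divr_gt0.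
apply: (@subclosed_compact _ _
    ([set x | e / 2 / (`|a| + 1) <= `|f x|] `|` [set x | e / 2 <= `|g x|])).
- rewrite (_ : [set _ | _] = ~` ((a *: f + g : X -> K^o) @^-1` ball (0 : K^o) e)).
    apply: open_closedC; apply: open_comp; last exact: ball_open.
    by move=> x _; exact: ch.
  apply/seteqP; split=> x; rewrite /= -ball_normE /= sub0r normrN.
    by move=> le_e lt_e; have := le_lt_trans le_e lt_e; rewrite ltxx.
  move=> /negP; rewrite real_ltNge ?normr_real// ?gtr0_real//.
  by rewrite negbK.
- by apply: compactU; [apply: vf; rewrite divr_gt0 | exact: vg].
- move=> x /= le_e; apply/orP; rewrite -[_ || _]negbK negb_or.
  rewrite -!real_ltNge ?normr_real// ?gtr0_real// ?divr_gt0//.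
  apply/negP => /andP[fx gx].
  have: `|(a *: f + g) x| < e.
    rewrite (le_lt_trans (ler_normD _ _))// [ltRHS]splitr ltrD//.
    rewrite normrM (@le_lt_trans _ _ ((`|a| + 1) * `|f x|))//.
      by rewrite ler_wpM2r// lerDl.
    by rewrite mulrC -ltr_pdivlMr.
  by move=> /(le_lt_trans le_e); rewrite ltxx.
Qed.

HB.instance Definition _ :=
  GRing.isSubmodClosed.Build K (X -> K^o) C0_pred C0_submod_closed.
HB.instance Definition _ := [SubChoice_isSubLmodule of C0 by <:].

Definition C0_abs_range (f : C0) : set R :=
  [set scalar_re `|f x| | x in [set: X]].

(* [sup set0 = 0], so the norm is also right when [X] is empty. *)
Definition C0_norm (f : C0) : K := scalar_of_real k (sup (C0_abs_range f)).

Lemma C0_has_ubound (f : C0) : has_ubound (C0_abs_range f).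
Proof.
have /C0_predP[cf vf] := C0_subproof f.
pose m x : R := scalar_re `|f x|.
have cm : continuous m.
  move=> x; apply/cvgrPdist_lt => e e0.
  have e0' : 0 < scalar_of_real k e.
    by rewrite -(scalar_of_real0 R k) ltr_scalar_of_real.
  have /cvgrPdist_lt /(_ _ e0') := cf x; apply: filterS => y xy.
  rewrite -(ltr_scalar_of_real k) -scalar_of_real_norm -scalar_reB.
  rewrite scalar_reK ?rpredB ?normr_real//.
  exact: le_lt_trans (ler_dist_dist _ _) xy.
have [M [_ bM]] : bounded_set (m @` [set x | (1 : K) <= `|f x|]).
  apply: compact_bounded; apply: continuous_compact; last exact: vf.
  exact: continuous_subspaceT.
exists (Num.max 1 (M + 1)) => _ [x _ <-]; rewrite le_max.
have [f1|f1] := boolP ((1 : K) <= `|f x|).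
  apply/orP; right; apply: le_trans (ler_norm _) _.
  by apply: (bM (M + 1)); [rewrite ltrDl | exists x].
apply/orP; left; rewrite -(ler_scalar_of_real k) scalar_re_norm.
rewrite (_ : scalar_of_real k 1 = 1); last by case: (k).
by rewrite ltW// real_ltNge ?normr_real// real1.
Qed.

Lemma C0_norm_ge (f : C0) x : `|f x| <= C0_norm f.
Proof.
rewrite -scalar_re_norm ler_scalar_of_real.
by apply: ub_le_sup; [exact: C0_has_ubound | exists x].
Qed.

Lemma C0_norm_le (f : C0) (c : K) :
  0 <= c -> (forall x, `|f x| <= c) -> C0_norm f <= c.
Proof.
move=> c0 fc; rewrite -(scalar_reK (ger0_real c0)) ler_scalar_of_real.
have [->|/set0P ne] := eqVneq (C0_abs_range f) set0.
  by rewrite sup0 -(ler_scalar_of_real k) scalar_of_real0 scalar_reK ?ger0_real.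
apply: ge_sup => // _ [x _ <-].
by rewrite -(ler_scalar_of_real k) !scalar_reK ?ger0_real.
Qed.

Lemma C0_norm_ge0 (f : C0) : 0 <= C0_norm f.
Proof.
have [A0|/set0P[_ [x _ _]]] := eqVneq (C0_abs_range f) set0.
  by rewrite /C0_norm A0 sup0 scalar_of_real0.
exact: le_trans (normr_ge0 _) (C0_norm_ge f x).
Qed.

Lemma C0_ler_normD (f g : C0) : C0_norm (f + g) <= C0_norm f + C0_norm g.
Proof.
apply: C0_norm_le => [|x]; first by rewrite addr_ge0 ?C0_norm_ge0.
by rewrite (le_trans (ler_normD (f x) (g x)))// lerD ?C0_norm_ge.
Qed.

Lemma C0_norm_leZ (a : K) (f : C0) : C0_norm (a *: f) <= `|a| * C0_norm f.
Proof.
apply: C0_norm_le => [|x]; first by rewrite mulr_ge0 ?C0_norm_ge0.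
by rewrite (normrM a (f x)) ler_wpM2l ?C0_norm_ge.
Qed.

Lemma C0_normrZ (a : K) (f : C0) : C0_norm (a *: f) = `|a| * C0_norm f.
Proof.
apply/eqP; rewrite eq_le C0_norm_leZ/=.
have [->|a0] := eqVneq a 0; first by rewrite normr0 mul0r C0_norm_ge0.
rewrite mulrC -ler_pdivlMr ?normr_gt0// mulrC -normfV.
by rewrite -{1}[f](scalerK a0) C0_norm_leZ.
Qed.

Lemma C0_normr0_eq0 (f : C0) : C0_norm f = 0 -> f = 0.
Proof.
move=> f0; apply/val_inj/funext => x; apply/eqP.
by rewrite -normr_le0 -f0; exact: C0_norm_ge.
Qed.

HB.instance Definition _ :=
  Lmodule_isNormed.Build K C0 C0_ler_normD C0_normrZ C0_normr0_eq0.

Definition norm_attaining_set (f : C0) : set X := [set x | `|f x| = `|f|].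

End C0.

Arguments C0 : clear implicits.

(* Main.v *)
Require Import Defs.
From HB Require Import structures.
From mathcomp Require Import all_boot all_order all_algebra.
From mathcomp Require Import complex.
From mathcomp Require Import all_classical all_reals all_analysis.
From mathcomp Require Import ring lra.

(** Write A for the set of the scalars [conj (f x) * g x] with [x] in the norm
attaining set of [f], and [re] for the real part.  Expanding
[|f x + l * g x|^2] shows that a scalar [l] lowers the modulus of [f x], to
first order, exactly when [re (l * (conj (f x) * g x)) < 0].

If [f + l *: g] has smaller norm than [f], its modulus is smaller than that of
[f] at every point of the norm attaining set.  So A lies in the convex half-plane
[re (l * z) < 0], which misses 0, and 0 is not in the convex hull of A
([convex_halfplane]).

Conversely, let [f] be orthogonal to [g].  No direction [l] can then lower
the modulus of [f] to first order on the whole norm attaining set: as [f] vanishes at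
infinity, the descent would be uniform in [x], by compactness, and a short step
in this direction would lower the norm ([uniform_descent_gap],
[birkhoff_james_attaining_re_ge0]).  Hence for each [l] some point of A satisfies
[0 <= re (l * z)]: A is contained in no open half-plane whose boundary passes
through 0.  It remains to see that 0 is in the convex hull of A when A is
compact.  The usual argument separates 0 from the hull, whose compactness rests
on Caratheodory's theorem.  In the plane it is enough to look at the point
nearest to 0 on the segments with both ends in A, which exists since those
segments form a compact family ([origin_in_convex_planar]).

The real case is the planar one with imaginary parts equal to 0, so both
scalar fields are treated at once through the real and imaginary parts. *)

Set Implicit Arguments.
Unset Strict Implicit.
Unset Printing Implicit Defensive.

Import Order.TTheory GRing.Theory Num.Theory.
Import numFieldNormedType.Exports.

Local Open Scope classical_set_scope.
Local Open Scope ring_scope.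

(** * Convex combinations in the plane *)

Section Plane.
Context {R : realType}.
Implicit Types a b p q s t : R.

(** The squared distance to the origin along a segment issuing from its point
(a, b) nearest to the origin has a nonnegative derivative at (a, b). *)
Lemma nearest_point_dot a b p q :
  (forall t, 0 <= t <= 1 ->
    a ^+ 2 + b ^+ 2 <=
      (t * p + (1 - t) * a) ^+ 2 + (t * q + (1 - t) * b) ^+ 2) ->
  a ^+ 2 + b ^+ 2 <= a * p + b * q.
Proof.
move=> near; rewrite leNgt; apply/negP => lt_dot.
pose d := a ^+ 2 + b ^+ 2 - (a * p + b * q).
pose e := (p - a) ^+ 2 + (q - b) ^+ 2.
have d0 : 0 < d by rewrite subr_gt0.
have e0 : 0 <= e by rewrite addr_ge0 ?sqr_ge0.
have ed0 : 0 < e + d by lra.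
(* The squared distance along the segment is a^2 + b^2 - 2 t d + t^2 e; this t
   makes the linear term dominate. *)
pose t := d / (e + d).
have t0 : 0 < t by rewrite divr_gt0.
have t1 : t <= 1 by rewrite ler_pdivrMr// mul1r lerDr.
have te : t * e <= d by rewrite mulrAC ler_pdivrMr// ler_pM2l//; lra.
have := near t; rewrite (ltW t0) t1 => /(_ isT).
have -> : (t * p + (1 - t) * a) ^+ 2 + (t * q + (1 - t) * b) ^+ 2 =
    a ^+ 2 + b ^+ 2 + t * (t * e - 2 * d) by rewrite /e /d; ring.
rewrite lerDl pmulr_rge0//; lra.
Qed.

(** Let w = (a, b) be the point nearest to 0 on the segments joining two points
(P x, Q x) with x in M.  If w is not 0, the hypothesis gives a point z of M whose
scalar product with w is nonpositive.  By [nearest_point_dot] both ends of the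
segment through w project onto w or beyond it.  As w is between them, either both
project onto w or w is one of them, and in each case an end c that projects
onto w is not strictly on the same side of the line (0 w) as z.  If c is w itself,
the segment from c to z comes nearer to 0 than w, which is absurd.  Otherwise the
segment from c to z meets the line (0 w) at a point r before w; as r is not
nearer to 0 than w, it lies beyond 0, and 0 is between w and r.

The points are given through P and Q on the index set, so that the compactness
needed is that of M; C is a convex planar set, as a relation between the
coordinates. *)
Lemma origin_in_convex_planar (X : topologicalType) (M : set X) (P Q : X -> R)
    (C : R -> R -> Prop) :
  compact M -> continuous P -> continuous Q ->
  (forall u v, exists2 x, M x & 0 <= u * P x + v * Q x) ->
  (forall p q p' q' s, 0 <= s <= 1 -> C p q -> C p' q' ->
    C (s * p + (1 - s) * p') (s * q + (1 - s) * q')) ->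
  (forall x, M x -> C (P x) (Q x)) ->
  C 0 0.
Proof.
move=> cM cP cQ hM convC MC.
pose F (h : X -> R) (w : X * X * R) := w.2 * h w.1.1 + (1 - w.2) * h w.1.2.
have cF h : continuous h -> continuous (F h).
  move=> ch w; apply: cvgD; apply: cvgM.
  - exact: cvg_snd.
  - apply: (@continuous_comp _ _ _ (fun w : X * X * R => w.1.1) h); last exact: ch.
    by apply: (@continuous_comp _ _ _ fst fst); exact: cvg_fst.
  - by apply: cvgB; [exact: cvg_cst | exact: cvg_snd].
  - apply: (@continuous_comp _ _ _ (fun w : X * X * R => w.1.2) h); last exact: ch.
    by apply: (@continuous_comp _ _ _ fst snd); [exact: cvg_fst | exact: cvg_snd].
have cF2 h : continuous h -> continuous (fun w => F h w ^+ 2).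
  move=> ch w; apply: (@continuous_comp _ _ _ (F h) (fun r : R => r ^+ 2)).
    exact: cF.
  exact: exprn_continuous.
pose N w := F P w ^+ 2 + F Q w ^+ 2.
pose S : set (X * X * R) := (M `*` M) `*` `[0, 1]%classic.
have [x0 Mx0 _] := hM 0 0.
have S0 : S !=set0.
  by exists ((x0, x0), 0); split => //=; rewrite in_itv/= lexx ler01.
have cS : compact S.
  by apply: compact_setX; [exact: compact_setX | exact: segment_compact].
have cN : {within S, continuous N}.
  apply: continuous_subspaceT => w.
  by apply: cvgD; exact: cF2.
have [[[x y] s] + minN] := compact_EVT_min S0 cS cN.
rewrite inE => -[[/= Mx My]]; rewrite in_itv/= => s01.
pose a := s * P x + (1 - s) * P y.
pose b := s * Q x + (1 - s) * Q y.
have Cab : C a b by apply: convC => //; exact: MC.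
have minab x' y' t : M x' -> M y' -> 0 <= t <= 1 -> a ^+ 2 + b ^+ 2 <=
    (t * P x' + (1 - t) * P y') ^+ 2 + (t * Q x' + (1 - t) * Q y') ^+ 2.
  move=> Mx' My' t01; apply: (minN ((x', y'), t)).
  by rewrite inE; split => //=; rewrite in_itv.
pose n := a ^+ 2 + b ^+ 2.
have [n0|n0] := eqVneq n 0.
  have /andP[] : (a ^+ 2 == 0) && (b ^+ 2 == 0).
    by rewrite -paddr_eq0 ?sqr_ge0//; apply/eqP.
  by rewrite !sqrf_eq0 => /eqP a0 /eqP b0; move: Cab; rewrite a0 b0.
have {n0}n_gt0 : 0 < n by rewrite lt_neqAle eq_sym n0 addr_ge0 ?sqr_ge0.
(* Coordinates in the orthogonal frame whose first axis points towards the
   nearest point (a, b), scaled by the square root of n. *)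
pose U z := a * P z + b * Q z.
pose V z := a * Q z - b * P z.
(* The segments from w = (a, b) to the ends x and y are parts of the minimising
   one, hence the reparametrisations below. *)
have Ux : n <= U x.
  apply: nearest_point_dot => t t01.
  have -> : t * P x + (1 - t) * a =
      (s + t * (1 - s)) * P x + (1 - (s + t * (1 - s))) * P y.
    by rewrite /a; ring.
  have -> : t * Q x + (1 - t) * b =
      (s + t * (1 - s)) * Q x + (1 - (s + t * (1 - s))) * Q y.
    by rewrite /b; ring.
  by apply: minab => //; nra.
have Uy : n <= U y.
  apply: nearest_point_dot => t t01.
  have -> : t * P y + (1 - t) * a = (s * (1 - t)) * P x + (1 - s * (1 - t)) * P y.
    by rewrite /a; ring.
  have -> : t * Q y + (1 - t) * b = (s * (1 - t)) * Q x + (1 - s * (1 - t)) * Q y.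
    by rewrite /b; ring.
  by apply: minab => //; nra.
have Un : s * (U x - n) + (1 - s) * (U y - n) = 0.
  by rewrite /U /n -/a -/b; rewrite /a /b; ring.
have V0 : s * V x + (1 - s) * V y = 0 by rewrite /V /a /b; ring.
have [z Mz Uz] := hM (- a) (- b).
have {}Uz : U z <= 0 by rewrite /U; lra.
(* The end of the minimising segment that is not strictly on the same side of the
   line through 0 and (a, b) as z. *)
have [c [Mc Uc Vc]] : exists c, [/\ M c, U c = n & V c * V z <= 0].
  have [s0|s0] := eqVneq s 0.
    by exists y; split => //; [move: Un | move: V0]; rewrite s0; nra.
  have [s1|s1] := eqVneq s 1.
    by exists x; split => //; [move: Un | move: V0]; rewrite s1; nra.
  have {s0}s_gt0 : 0 < s by rewrite lt_neqAle eq_sym s0; case/andP: s01.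
  have {s1}s_lt1 : 0 < 1 - s by rewrite subr_gt0 lt_neqAle s1; case/andP: s01.
  have Uxn : U x = n.
    by apply/eqP; rewrite eq_le Ux andbT -subr_le0 -(pmulr_rle0 _ s_gt0); nra.
  have Uyn : U y = n.
    by apply/eqP; rewrite eq_le Uy andbT -subr_le0 -(pmulr_rle0 _ s_lt1); nra.
  have [Vxz|Vxz] := leP (V x * V z) 0; first by exists x.
  exists y; split => //; rewrite -(pmulr_rle0 _ s_lt1).
  have -> : (1 - s) * (V y * V z) = - (s * (V x * V z)).
    by apply/eqP; rewrite -subr_eq0 opprK; apply/eqP;
       rewrite -[RHS](mul0r (V z)) -V0; ring.
  by rewrite oppr_le0 mulr_ge0// ltW.
have [Vc0|Vc0] := eqVneq (V c) 0.
  (* Then c lies at (a, b), and a step towards z would come nearer to the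
     origin. *)
  have Pc : P c = a.
    apply: (mulfI (lt0r_neq0 n_gt0)); rewrite -{2}Uc.
    have -> : n * P c = a * U c - b * V c by rewrite /n /U /V; ring.
    by rewrite Vc0; ring.
  have Qc : Q c = b.
    apply: (mulfI (lt0r_neq0 n_gt0)); rewrite -{2}Uc.
    have -> : n * Q c = b * U c + a * V c by rewrite /n /U /V; ring.
    by rewrite Vc0; ring.
  have : n <= U z.
    apply: nearest_point_dot => t t01.
    by have := minab _ _ _ Mz Mc t01; rewrite Pc Qc.
  by lra.
(* The weight at which the segment from z to c meets the line through 0 and
   (a, b). *)
pose k := `|V z| / (`|V z| + `|V c|).
have Vc_gt0 : 0 < `|V c| by rewrite normr_gt0.
have den_gt0 : 0 < `|V z| + `|V c| by rewrite ltr_wpDl.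
have k0 : 0 <= k by rewrite divr_ge0// ltW.
have k1 : k < 1 by rewrite ltr_pdivrMr// mul1r ltrDl.
have k01 : 0 <= k <= 1 by rewrite k0 ltW.
pose rp := k * P c + (1 - k) * P z.
pose rq := k * Q c + (1 - k) * Q z.
pose m := a * rp + b * rq.
have r_axis : a * rq - b * rp = 0.
  have -> : a * rq - b * rp = k * V c + (1 - k) * V z by rewrite /rp /rq /V; ring.
  have -> : 1 - k = `|V c| / (`|V z| + `|V c|) by rewrite /k; field; lra.
  rewrite /k -!mulrA ![_^-1 * _]mulrC !mulrA -mulrDl.
  suff -> : `|V z| * V c + `|V c| * V z = 0 by rewrite mul0r.
  case: (ltrgtP (V c) 0) Vc0 Vc => [c0|c0|//] _.
    by rewrite nmulr_rle0// => z0; rewrite (ltr0_norm c0) (ger0_norm z0); ring.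
  by rewrite pmulr_rle0// => z0; rewrite (gtr0_norm c0) (ler0_norm z0); ring.
(* The crossing point is m / n times (a, b). *)
have m_lt : m < n.
  have -> : m = k * U c + (1 - k) * U z by rewrite /m /rp /rq /U; ring.
  by rewrite Uc; nra.
have m2 : n ^+ 2 <= m ^+ 2.
  have -> : m ^+ 2 = n * (rp ^+ 2 + rq ^+ 2).
    have -> : n * (rp ^+ 2 + rq ^+ 2) = m ^+ 2 + (a * rq - b * rp) ^+ 2.
      by rewrite /n /m; ring.
    by rewrite r_axis; ring.
  by rewrite expr2 ler_pM2l//; exact: minab.
have m_lt0 : m < 0 by nra.
have Cr : C rp rq by apply: convC => //; exact: MC.
have nm0 : 0 < n - m by lra.
have rpE : rp = m * a / n.
  apply/eqP; rewrite eq_sym -subr_eq0; apply/eqP.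
  have -> : m * a / n - rp = b * (a * rq - b * rp) / n.
    by rewrite /m /n; field; rewrite -/n; lra.
  by rewrite r_axis; ring.
have rqE : rq = m * b / n.
  apply/eqP; rewrite eq_sym -subr_eq0; apply/eqP.
  have -> : m * b / n - rq = - (a * (a * rq - b * rp)) / n.
    by rewrite /m /n; field; rewrite -/n; lra.
  by rewrite r_axis; ring.
have t01 : 0 <= - m / (n - m) <= 1.
  by rewrite divr_ge0 ?ler_pdivrMr//; lra.
have := convC _ _ _ _ _ t01 Cab Cr.
rewrite rpE rqE.
have -> : - m / (n - m) * a + (1 - - m / (n - m)) * (m * a / n) = 0.
  by field; rewrite !lt0r_neq0.
have -> // : - m / (n - m) * b + (1 - - m / (n - m)) * (m * b / n) = 0.
by field; rewrite !lt0r_neq0.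
Qed.

End Plane.

(** * Real and imaginary parts of scalars *)

Section Scalars.
Context {R : realType} {k : scalar_kind}.
Local Notation K := (scalar_field R k).
Local Notation re := (@scalar_re R k).
Local Notation conj := (@scalar_conj R k).
Local Notation inR := (@scalar_of_real R k).

Definition scalar_im : K -> R :=
  match k return scalar_field R k -> R with
  | RealScalars => fun=> 0 | ComplexScalars => @complex.Im R
  end.
Local Notation im := scalar_im.

(** The squared modulus as an element of [R] rather than of the scalar field,
where the order is only partial in the complex case. *)
Definition sqnorm (z : K) : R := re z ^+ 2 + im z ^+ 2.

Lemma scalar_eqP (z w : K) : re z = re w -> im z = im w -> z = w.
Proof. by rewrite /scalar_im; case: k z w => //= -[? ?] [? ?] /= -> ->. Qed.

Lemma scalar_of_real1 : inR 1 = 1. Proof. by case: k. Qed.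

Lemma scalar_imB : {morph im : z w / z - w}.
Proof. by rewrite /scalar_im; case: k => [z w|[? ?] [? ?]] //=; rewrite subr0. Qed.

Lemma scalar_re_conjM (z w : K) : re (conj z * w) = re z * re w + im z * im w.
Proof. by rewrite /scalar_im; case: k z w => [z w|[? ?] [? ?]] /=; ring. Qed.

Lemma scalar_im_conjM (z w : K) : im (conj z * w) = re z * im w - im z * re w.
Proof. by rewrite /scalar_im; case: k z w => [z w|[? ?] [? ?]] /=; ring. Qed.

Lemma scalar_re_comb (s : R) (z w : K) :
  re (inR s * z + (1 - inR s) * w) = s * re z + (1 - s) * re w.
Proof. by case: k z w => [z w|[? ?] [? ?]] /=; ring. Qed.

Lemma scalar_im_comb (s : R) (z w : K) :
  im (inR s * z + (1 - inR s) * w) = s * im z + (1 - s) * im w.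
Proof. by rewrite /scalar_im; case: k z w => [z w|[? ?] [? ?]] /=; ring. Qed.

(** Real linear forms on the scalar field are real parts of multiplications,
so a direction in the plane of scalars amounts to a scalar factor. *)
Lemma scalar_functional (u v : R) :
  exists l : K, forall z, re (l * z) = u * re z + v * im z.
Proof.
rewrite /scalar_im; case: k => /=.
  by exists u => z; rewrite mulr0 addr0.
by exists (Complex u (- v)) => -[a b] /=; ring.
Qed.

Lemma sqnorm_ge0 z : 0 <= sqnorm z.
Proof. by rewrite addr_ge0 ?sqr_ge0. Qed.

Lemma scalar_normE z : `|z| = inR (Num.sqrt (sqnorm z)).
Proof.
rewrite /sqnorm /scalar_im; case: k z => /= z; last exact: normc_def.
by rewrite expr0n addr0 sqrtr_sqr.
Qed.

Lemma sqnormD z w : sqnorm (z + w) = sqnorm z + 2 * re (conj z * w) + sqnorm w.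
Proof.
by rewrite /sqnorm /scalar_im; case: k z w => [z w|[? ?] [? ?]] /=; ring.
Qed.

Lemma ltr_sqnorm z w : (sqnorm z < sqnorm w) = (`|z| < `|w|).
Proof.
rewrite !scalar_normE ltr_scalar_of_real.
have [->|] := eqVneq (sqnorm w) 0.
  by rewrite sqrtr0 !ltNge sqrtr_ge0 sqnorm_ge0.
by move=> w0; rewrite ltr_sqrt// lt_neqAle eq_sym w0 sqnorm_ge0.
Qed.

Lemma re_conjM_le z w : 2 * re (conj z * w) <= sqnorm z + sqnorm w.
Proof.
rewrite scalar_re_conjM /sqnorm -subr_ge0.
have -> // : forall a b c d : R, a ^+ 2 + b ^+ 2 + (c ^+ 2 + d ^+ 2) -
    2 * (a * c + b * d) = (a - c) ^+ 2 + (b - d) ^+ 2 by move=> *; ring.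
by rewrite addr_ge0 ?sqr_ge0.
Qed.

Lemma scalar_re_le_norm z : inR `|re z| <= `|z|.
Proof.
rewrite scalar_normE ler_scalar_of_real -sqrtr_sqr.
by rewrite ler_wsqrtr// lerDl sqr_ge0.
Qed.

Lemma scalar_im_le_norm z : inR `|im z| <= `|z|.
Proof.
rewrite scalar_normE ler_scalar_of_real -sqrtr_sqr.
by rewrite ler_wsqrtr// lerDr sqr_ge0.
Qed.

Lemma contraction_comp_continuous (X : topologicalType) (p : K -> R) (h : X -> K^o) :
  {morph p : z w / z - w} -> (forall z, inR (`|p z|) <= `|z|) ->
  continuous h -> continuous (p \o h).
Proof.
move=> pB ple ch x; apply/cvgrPdist_lt => e e0.
have e0' : 0 < inR e by rewrite -(scalar_of_real0 R k) ltr_scalar_of_real.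
have /cvgrPdist_lt /(_ _ e0') := ch x; apply: filterS => y xy.
rewrite -(ltr_scalar_of_real k) /= -pB.
exact: le_lt_trans (ple _) xy.
Qed.

End Scalars.

(** * Birkhoff-James orthogonality in the space of functions vanishing at infinity *)

Section C0Geometry.
Context {R : realType} {k : scalar_kind} {X : topologicalType}.
Local Notation K := (scalar_field R k).
Local Notation re := (@scalar_re R k).
Local Notation im := (@scalar_im R k).
Local Notation conj := (@scalar_conj R k).
Local Notation inR := (@scalar_of_real R k).
Implicit Types f g : C0 R k X.

Lemma C0_scaleE f (l : K) x : (l *: f) x = l * f x.
Proof. by []. Qed.

Lemma C0_addZE f g (l : K) x : (f + l *: g) x = f x + l * g x.
Proof. by []. Qed.

Lemma C0_re_continuous f : continuous (re \o f : X -> R).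
Proof.
have /C0_predP[cf _] := C0_subproof f.
apply: contraction_comp_continuous cf; [exact: scalar_reB | exact: scalar_re_le_norm].
Qed.

Lemma C0_im_continuous f : continuous (im \o f : X -> R).
Proof.
have /C0_predP[cf _] := C0_subproof f.
apply: contraction_comp_continuous cf; [exact: scalar_imB | exact: scalar_im_le_norm].
Qed.

Lemma C0_re_conjM_continuous f g : continuous (fun x => re (conj (f x) * g x)).
Proof.
under eq_fun do rewrite scalar_re_conjM.
by move=> x; apply: cvgD; apply: cvgM;
  solve [exact: C0_re_continuous | exact: C0_im_continuous].
Qed.

Lemma C0_im_conjM_continuous f g : continuous (fun x => im (conj (f x) * g x)).
Proof.
under eq_fun do rewrite scalar_im_conjM.
by move=> x; apply: cvgB; apply: cvgM;
  solve [exact: C0_re_continuous | exact: C0_im_continuous].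
Qed.

Lemma C0_sqnorm_continuous f : continuous (fun x => sqnorm (f x)).
Proof.
by move=> x; apply: cvgD; apply: cvgM;
  solve [exact: C0_re_continuous | exact: C0_im_continuous].
Qed.

Lemma C0_sqnorm_le f x : sqnorm (f x) <= sqnorm (`|f| : K).
Proof.
rewrite leNgt ltr_sqnorm normr_id -real_leNgt ?normr_real//.
exact: C0_norm_ge.
Qed.

Lemma norm_attaining_setE f x :
  norm_attaining_set f x <-> sqnorm (f x) = sqnorm (`|f| : K).
Proof.
split=> [<-|]; first by apply/eqP; rewrite eq_le !leNgt !ltr_sqnorm normr_id ltxx.
move=> e; rewrite /norm_attaining_set/= scalar_normE e -scalar_normE.
exact: normr_id.
Qed.

(** The norm attaining set is the superlevel set of [|f|] at its own norm, which
is positive. *)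
Lemma compact_norm_attaining_set f : f != 0 -> compact (norm_attaining_set f).
Proof.
move=> f0; have /C0_predP[_ vf] := C0_subproof f.
have -> : norm_attaining_set f = [set x | `|f| <= `|f x|].
  apply/seteqP; split => x /=; first by move=> ->.
  by move=> h; apply/eqP; rewrite eq_le h andbT; exact: C0_norm_ge.
by apply: vf; rewrite normr_gt0.
Qed.

Lemma birkhoff_james_orthogonalZ f g (l : K) :
  birkhoff_james_orthogonal f g -> birkhoff_james_orthogonal f (l *: g).
Proof. by move=> fg m; rewrite scalerA. Qed.

(** Strict descent on the norm attaining set is uniform: near this set the first
order term is bounded away from 0, and away from it the modulus of [f] stays
below the norm.  Both alternatives are measured by the minimum of two continuous
functions, negative on the compact set where [|f|] is at least half its norm;
outside this set the second alternative holds with an explicit gap. *)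
Lemma uniform_descent_gap f g : f != 0 ->
  (forall x, norm_attaining_set f x -> re (conj (f x) * g x) < 0) ->
  exists2 d : R, 0 < d & forall x,
    re (conj (f x) * g x) <= - d \/ sqnorm (f x) <= sqnorm (`|f| : K) - d.
Proof.
move=> f0 neg; have /C0_predP[_ vf] := C0_subproof f.
pose m2 := sqnorm (`|f| : K).
have nf_gt0 : 0 < `|f| by rewrite normr_gt0.
have m2_gt0 : 0 < m2.
  by rewrite lt_neqAle sqnorm_ge0 andbT eq_sym; apply: contraTneq nf_gt0 => m0;
     rewrite -normr_id scalar_normE -/m2 m0 sqrtr0 scalar_of_real0 ltxx.
pose S := [set x | `|f| / 2 <= `|f x|].
have cS : compact S by apply: vf; rewrite divr_gt0.
pose h := (fun x => re (conj (f x) * g x)) \min (fun x => sqnorm (f x) - m2).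
have ch : {within S, continuous h}.
  apply: continuous_subspaceT => x; apply: continuous_min.
    exact: C0_re_conjM_continuous.
  by apply: cvgB; [exact: C0_sqnorm_continuous | exact: cvg_cst].
have [d d_gt0 hd] : exists2 d, 0 < d & forall x, S x -> h x <= - d.
  have [S0|/set0P S0] := eqVneq S set0.
    by exists 1 => // x; rewrite S0.
  have [c _ maxc] := compact_EVT_max S0 cS ch.
  exists (- h c); last by move=> x Sx; rewrite opprK; apply: maxc; rewrite inE.
  rewrite oppr_gt0 /h /= gt_min subr_lt0.
  have [/norm_attaining_setE/neg -> //|fc] := pselect (sqnorm (f c) = m2).
  by rewrite [sqnorm _ < _]lt_neqAle C0_sqnorm_le andbT; apply/orP; right; apply/eqP.
(* Where |f| is less than half its norm, its square falls short of m2 by at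
   least three quarters of m2. *)
exists (Num.min d (m2 * (3 / 4))); first by rewrite lt_min d_gt0 mulr_gt0.
move=> x; have [Sx|nSx] := pselect (S x).
  have := hd x Sx; rewrite /h /= ge_min => /orP[]; [left|right];
    have : Num.min d (m2 * (3 / 4)) <= d by rewrite ge_min lexx.
    by lra.
  by rewrite -/m2; lra.
right; have : Num.min d (m2 * (3 / 4)) <= m2 * (3 / 4) by rewrite ge_min lexx orbT.
suff : sqnorm (f x) < m2 / 4 by rewrite -/m2; lra.
have -> : m2 / 4 = sqnorm (`|f| / 2 : K).
  rewrite /m2 /sqnorm /scalar_im; case: (k) (`|f|) => /= [z|[a b]]; first by field.
  by rewrite -[2 : R[i]](rmorph_nat (@real_complex R)) -fmorphV /=; field.
rewrite ltr_sqnorm [X in _ < X]ger0_norm ?divr_ge0//.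
by rewrite real_ltNge ?normr_real ?ger0_real ?divr_ge0//; apply/negP.
Qed.

(** Otherwise a small positive multiple [t] of [g] lowers the norm.  By
[uniform_descent_gap], at each point either the term linear in [t] gains [2 t d],
or [|f x|^2] has a margin [d]; for [t] small both outweigh the terms that [g]
may add. *)
Lemma birkhoff_james_attaining_re_ge0 f g : f != 0 ->
  birkhoff_james_orthogonal f g ->
  exists2 x, norm_attaining_set f x & 0 <= re (conj (f x) * g x).
Proof.
move=> f0 fg; apply: contrapT => no.
have neg x : norm_attaining_set f x -> re (conj (f x) * g x) < 0.
  by move=> Mx; rewrite ltNge; apply/negP => ge0; apply: no; exists x.
have [d d_gt0 hd] := uniform_descent_gap f0 neg.
pose m2 := sqnorm (`|f| : K); pose b2 := sqnorm (`|g| : K).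
have m2_ge0 : 0 <= m2 by exact: sqnorm_ge0.
have b2_ge0 : 0 <= b2 by exact: sqnorm_ge0.
(* The linear coefficient is at most m2 + b2, and the quadratic one at most b2;
   with this t, t (m2 + b2) is at most d / 4, and t^2 b2 at most t d / 4. *)
pose t := d / (4 * (m2 + b2) + d).
have den_gt0 : 0 < 4 * (m2 + b2) + d by lra.
have t_gt0 : 0 < t by rewrite divr_gt0.
have t_le1 : t <= 1 by rewrite ler_pdivrMr//; lra.
have tL : t * (4 * (m2 + b2)) <= d by rewrite mulrAC ler_pdivrMr// ler_pM2l//; lra.
have td_gt0 : 0 < t * d by rewrite mulr_gt0.
have bound x : sqnorm ((f + inR t *: g) x) <= m2 - t * d / 2.
  have -> : sqnorm ((f + inR t *: g) x) =
      sqnorm (f x) + 2 * t * re (conj (f x) * g x) + t ^+ 2 * sqnorm (g x).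
    rewrite C0_addZE sqnormD.
    rewrite /sqnorm /scalar_im; case: (k) (f x) (g x) => [z w|[? ?] [? ?]] /=; ring.
  have fx : sqnorm (f x) <= m2 := C0_sqnorm_le f x.
  have gx : sqnorm (g x) <= b2 := C0_sqnorm_le g x.
  have re_le := re_conjM_le (f x) (g x).
  have g0 := sqnorm_ge0 (g x).
  have tt : t ^+ 2 * sqnorm (g x) <= t * (t * b2) by rewrite -mulrA ler_pM2l// ler_pM2l.
  have tb : t * (t * b2) <= t * (d / 4) by rewrite ler_pM2l//; nra.
  have td : t * d <= d by rewrite ler_piMl// ltW.
  case: (hd x) => [neg_re|fx_small].
    have : t * re (conj (f x) * g x) <= t * - d by rewrite ler_pM2l.
    by lra.
  have : t * (2 * re (conj (f x) * g x)) <= t * (m2 + b2) by rewrite ler_pM2l//; lra.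
  by rewrite -/m2 in fx_small; lra.
have m2_gt : m2 - t * d / 2 < m2 by lra.
have [x _] : exists x : X, True.
  apply: contrapT => noX; case/eqP: f0; apply/val_inj/funext => x.
  by case: noX; exists x.
have c0 : 0 <= m2 - t * d / 2 := le_trans (sqnorm_ge0 _) (bound x).
have := fg (inR t); rewrite real_leNgt ?normr_real// => /negP; apply.
apply: (@le_lt_trans _ _ (inR (Num.sqrt (m2 - t * d / 2)))).
  apply: C0_norm_le => [|y].
    by rewrite -(scalar_of_real0 R k) ler_scalar_of_real sqrtr_ge0.
  by rewrite scalar_normE ler_scalar_of_real ler_wsqrtr.
rewrite -normr_id scalar_normE ltr_scalar_of_real ltr_sqrt//.
exact: le_lt_trans m2_gt.
Qed.

(** Weights in the abstract convex structure are scalars between 0 and 1; these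
are the images of the reals of the unit interval. *)
Lemma convex_set_comb (D : set (convex_lmodType K^o)) (s : R) (z w : K) :
  convex_set D -> 0 <= s <= 1 -> D z -> D w -> D (inR s * z + (1 - inR s) * w).
Proof.
move=> cD /andP[s0 s1] Dz Dw.
have i0 : 0 <= inR s by rewrite -(scalar_of_real0 R k) ler_scalar_of_real.
have i1 : inR s <= 1.
  by rewrite -(@scalar_of_real1 R k) ler_scalar_of_real.
have := cD z w (Itv01 i0 i1); rewrite !inE => /(_ Dz Dw).
by [].
Qed.

Lemma convex_halfplane (l : K) :
  convex_set ([set z | re (l * z) < 0] : set (convex_lmodType K^o)).
Proof.
move=> z w s; rewrite !inE /= => zneg wneg.
have s01 : 0 <= s%:num <= 1 by apply/andP.
have [s0 s1] := andP s01.
pose r := re s%:num.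
have sE : s%:num = inR r by rewrite /r scalar_reK// ger0_real.
have r0 : 0 <= r by rewrite -(ler_scalar_of_real k) scalar_of_real0 -sE.
have r1 : r <= 1 by rewrite -(ler_scalar_of_real k) scalar_of_real1 -sE.
rewrite -[X in re (l * X)]/(s%:num * z + (1 - s%:num) * w).
rewrite sE (_ : l * _ = inR r * (l * z) + (1 - inR r) * (l * w)); last by ring.
rewrite scalar_re_comb; nra.
Qed.

End C0Geometry.

Theorem theorem1p1p2 (R : realType) (k : scalar_kind) (X : topologicalType)
    (lcX : locally_compact [set: X]) (hsX : hausdorff_space X)
    (f g : C0 R k X) (f_neq0 : f != 0) :
  birkhoff_james_orthogonal f g <->
  convex_hull [set scalar_conj (f x) * g x | x in norm_attaining_set f] 0.
Proof.
split=> [fg D [cD subD]|hull l].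
- pose C p q := exists z, [/\ D z, scalar_re z = p & scalar_im z = q].
  suff [z [Dz z0 z0']] : C 0 0.
    suff <- : z = 0 by [].
    by apply: scalar_eqP; rewrite ?z0 ?z0' /scalar_im; case: (k).
  apply: (@origin_in_convex_planar _ _ (norm_attaining_set f)
    (fun x => scalar_re (scalar_conj (f x) * g x))
    (fun x => scalar_im (scalar_conj (f x) * g x))).
  + exact: compact_norm_attaining_set.
  + exact: C0_re_conjM_continuous.
  + exact: C0_im_conjM_continuous.
  + move=> u v; have [l lE] := @scalar_functional R k u v.
    have [x Mx] := birkhoff_james_attaining_re_ge0 f_neq0
      (birkhoff_james_orthogonalZ l fg).
    rewrite C0_scaleE mulrCA lE => ge0.
    by exists x.
  + move=> p q p' q' s s01 [z [Dz <- <-]] [w [Dw <- <-]].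
    exists (scalar_of_real k s * z + (1 - scalar_of_real k s) * w); split.
    * exact: convex_set_comb.
    * exact: scalar_re_comb.
    * exact: scalar_im_comb.
  + by move=> x Mx; exists (scalar_conj (f x) * g x); split => //; apply: subD; exists x.
- rewrite real_leNgt ?normr_real//; apply/negP => lt_norm.
  suff /(hull _) : [set M | convex_set M /\
      [set scalar_conj (f x) * g x | x in norm_attaining_set f] `<=` M]
      [set z : scalar_field R k | scalar_re (l * z) < 0].
    by rewrite /= mulr0 (_ : scalar_re 0 = 0) ?ltxx//; case: (k).
  split; first exact: convex_halfplane.
  move=> _ [x Mx <-] /=.
  have : sqnorm ((f + l *: g) x) < sqnorm (f x).
    rewrite ltr_sqnorm Mx; apply: le_lt_trans lt_norm; exact: C0_norm_ge.
  rewrite C0_addZE sqnormD mulrCA.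
  by have := sqnorm_ge0 (l * g x); lra.
Qed.
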